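(* Let $d\ge 2$ and $k\ge 1$ be integers, and let $G$ be an $n$-vertex $d$-regular graph containing two edges at distance at least $2k+2$. Then \[ \frac{\lambda_2(G)}{\lambda_n(G)}<\frac{d-2\sqrt{d-1}}{d+2\sqrt{d-1}}+\frac{4}{(k+1)\sqrt{d-1}}. \]
   Context: All graphs are finite and simple. For a graph $G$ on $n$ vertices, $L_G=D_G-A_G$ is its Laplacian matrix, with eigenvalues $0=\lambda_1(G)\le\cdots\le\lambda_n(G)$. $\operatorname{dist}_G(u,v)$ is the length of a shortest path between $u$ and $v$ ($\infty$ if none exists). The distance between edges $e=xy$ and $f=uv$ is $\min\{\operatorname{dist}_G(x,u),\operatorname{dist}_G(x,v),\operatorname{dist}_G(y,u),\operatorname{dist}_G(y,v)\}$. *)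

(* Defs.v *)
From HB Require Import structures.
From mathcomp Require Import all_boot all_order all_algebra.
From mathcomp Require Import classical_sets reals constructive_ereal ereal.
From mathcomp Require Import polyorder polyrcf.

Set Implicit Arguments.
Unset Strict Implicit.
Unset Printing Implicit Defensive.

Import Order.TTheory GRing.Theory Num.Theory.

Local Open Scope classical_set_scope.
Local Open Scope ring_scope.

Record simple_graph (T : finType) := SimpleGraph {
  adj :> rel T;
  adj_sym : symmetric adj;
  adj_irrefl : irreflexive adj }.

Definition degree (T : finType) (G : simple_graph T) (x : T) : nat :=
  #|[set y | G x y]%SET|.

Definition regular (T : finType) (d : nat) (G : simple_graph T) : Prop :=
  forall x : T, degree G x = d.

(* The vertices index rows and columns through [enum_val]. *)
Definition adjacency_mx (R : realType) (T : finType) (G : simple_graph T) :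
    'M[R]_#|T| :=
  \matrix_(i, j) (G (enum_val i) (enum_val j))%:R.

Definition degree_mx (R : realType) (T : finType) (G : simple_graph T) :
    'M[R]_#|T| :=
  diag_mx (\row_i (degree G (enum_val i))%:R).

Definition laplacian (R : realType) (T : finType) (G : simple_graph T) :
    'M[R]_#|T| :=
  degree_mx R G - adjacency_mx R G.

(* The real eigenvalues of [A], in nondecreasing order and repeated according
   to their algebraic multiplicity: [rootsR p] is the strictly increasing list
   of the real roots of [p], and [\mu_x p] the multiplicity of [x] in [p].
   For a symmetric [A], such as a Laplacian, this list has length [m]. *)
Definition eigenvalues (R : realType) (m : nat) (A : 'M[R]_m) : seq R :=
  flatten [seq nseq (\mu_x (char_poly A)) x | x <- rootsR (char_poly A)].

(* [lambda R G i] is the [i]-th smallest Laplacian eigenvalue, counting from 1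
   (a junk value when [i = 0] or [#|T| < i]). *)
Definition lambda (R : realType) (T : finType) (G : simple_graph T) (i : nat) :
    R :=
  nth 0 (eigenvalues (laplacian R G)) i.-1.

(* [p] lists the vertices of the path after [u], so [size p] is its length. *)
Definition is_path_between (T : finType) (G : simple_graph T) (u v : T)
    (p : seq T) : Prop :=
  [/\ path G u p, uniq (u :: p) & last u p = v].

(* The infimum of the empty set is [+oo], the distance between vertices in
   different components. *)
Definition dist (R : realType) (T : finType) (G : simple_graph T) (u v : T) :
    \bar R :=
  ereal_inf [set (size p)%:R%:E | p in [set p | is_path_between G u v p]].

Definition edge_dist (R : realType) (T : finType) (G : simple_graph T)
    (x y u v : T) : \bar R :=
  Order.min (Order.min (dist R G x u) (dist R G x v))
            (Order.min (dist R G y u) (dist R G y v)).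

(* Main.v *)
Require Import Defs.
From mathcomp Require Import all_boot all_order all_algebra all_fingroup.
From mathcomp Require Import reals constructive_ereal ereal.
From mathcomp Require Import polyorder polyrcf complex spectral sesquilinear.
From mathcomp Require Import ring lra zify.

(** Around each of the two edges put the radial function equal to [q^-i] on the
    vertices at distance [i <= k] and to [0] elsewhere, where [q = sqrt (d - 1)].
    The two functions have disjoint supports joined by no edge, so for one of
    them, [f], the Rayleigh quotient bounds [lambda_2] from above. Changing the
    sign of [f] on odd levels gives [g] of the same norm, whose Rayleigh quotient
    bounds [lambda_n] from below. Hence [lambda_2 / lambda_n] is at most the
    ratio of the Laplacian energies of [f] and [g]. *)

Set Implicit Arguments.
Unset Strict Implicit.
Unset Printing Implicit Defensive.

Import Order.TTheory GRing.Theory Num.Theory.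
Local Open Scope ring_scope.
Local Open Scope sesquilinear_scope.

(** * The eigenvalue list and the roots of the characteristic polynomial *)

Lemma sorted_flatten_nseq (R : realType) (f : R -> nat) (s : seq R) :
  sorted <%R s -> sorted <=%R (flatten [seq nseq (f x) x | x <- s]).
Proof.
rewrite (sorted_pairwise lt_trans) (sorted_pairwise le_trans).
elim: s => //= x s IHs /andP[/allP xs /IHs {}IHs].
rewrite pairwise_cat IHs andbT; apply/andP; split.
  apply/allrelP => y z /nseqP[-> _] /flatten_mapP[w ws /nseqP[-> _]].
  exact/ltW/xs.
elim: (f x) => //= n ->; rewrite andbT.
by apply/allP => y /nseqP[-> _].
Qed.

Lemma eigenvalues_sorted (R : realType) m (A : 'M[R]_m) :
  sorted <=%R (eigenvalues A).
Proof. exact/sorted_flatten_nseq/sorted_roots. Qed.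

Lemma count_flatten_nseq (T : eqType) (f : T -> nat) (s : seq T) (x : T) :
  uniq s ->
  count_mem x (flatten [seq nseq (f y) y | y <- s]) =
  if x \in s then f x else 0%N.
Proof.
elim: s => //= y s IHs /andP[ys us].
rewrite count_cat count_nseq IHs // inE eq_sym /=.
case: eqVneq => [eyx|_]; last by rewrite mul0n.
by rewrite -eyx (negbTE ys) mul1n addn0.
Qed.

Lemma mu_prod_XsubC (R : realType) (I : Type) (s : seq I) (r : I -> R) (x : R) :
  \mu_x (\prod_(i <- s) ('X - (r i)%:P)) = count_mem x (map r s).
Proof.
elim: s => [|i s IHs]; first by rewrite big_nil -polyC1 mu_polyC.
rewrite big_cons mu_mul ?IHs; last first.
  by rewrite mulf_neq0 ?polyXsubC_eq0 // monic_neq0 // monic_prod_XsubC.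
rewrite /=; congr (_ + _)%N.
case: eqVneq => [->|rx]; first exact: mu_XsubC.
by apply: muNroot; rewrite root_XsubC eq_sym.
Qed.

(** Each [x] occurs in both lists as often as its multiplicity as a root, so any splitting into
    linear factors gives the eigenvalue list up to order. *)
Lemma perm_eigenvalues (R : realType) m (A : 'M[R]_m) (I : Type) (s : seq I)
    (r : I -> R) :
  char_poly A = \prod_(i <- s) ('X - (r i)%:P) ->
  perm_eq (eigenvalues A) (map r s).
Proof.
move=> charA; have nz: char_poly A != 0 by apply/monic_neq0/char_poly_monic.
apply/allP => x _ /=; rewrite /eigenvalues count_flatten_nseq; last first.
  exact: (sorted_uniq lt_trans (@ltxx _ _) (sorted_roots _ _ _)).
rewrite -[X in _ == X]mu_prod_XsubC -charA.
have := roots_on_rootsR nz x; rewrite /= => <-.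
by case: ifP => // /negbT/muNroot ->.
Qed.

Lemma char_poly_unitary_diag (C : numClosedFieldType) n (P : 'M[C]_n)
    (D : 'rV[C]_n) : P \is unitarymx ->
  char_poly (P^t* *m diag_mx D *m P) = \prod_i ('X - (D 0 i)%:P).
Proof.
move=> uP; set Pp := map_mx polyC P; set Qp := map_mx polyC (P^t*).
have QP : Qp *m Pp = 1%:M.
  rewrite -map_mxM -(invmx_unitary uP) mulVmx ?unitarymx_unit //.
  by rewrite map_scalar_mx rmorph1.
have -> : char_poly (P^t* *m diag_mx D *m P) = char_poly (diag_mx D).
  rewrite /char_poly.
  have -> : char_poly_mx (P^t* *m diag_mx D *m P) =
            Qp *m char_poly_mx (diag_mx D) *m Pp.
    rewrite /char_poly_mx mulmxBr mulmxBl !map_mxM /=.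
    by rewrite mul_mx_scalar -scalemxAl QP scalemx1.
  rewrite !det_mulmx mulrAC -det_mulmx QP det1 mul1r //.
rewrite char_poly_trig ?diag_mx_is_trig //.
by apply: eq_bigr => i _; rewrite mxE eqxx mulr1n.
Qed.

(** * Diagonalization and Rayleigh quotients of real symmetric matrices *)

Section SymmetricMatrix.
Variables (R : realType) (m : nat) (A : 'M[R]_m).
Hypothesis symA : A^T = A.

Local Notation toC := (map_mx (real_complex R)).

(** The spectral theorem over [R[i]] gives real diagonal entries in no particular order; being the
    roots of [char_poly A], they are the sorted list up to a permutation [s]. *)
Lemma symmetric_diagonalization :
  exists (P : 'M[R[i]]_m) (s : 'S_m),
    [/\ P \is unitarymx, size (eigenvalues A) = m &
        toC A = P^t* *m
          diag_mx (\row_i (real_complex R (nth 0 (eigenvalues A) (s i)))) *m P].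
Proof.
have hermA : toC A \is hermsymmx.
  apply: realsym_hermsym.
    by apply/is_hermitianmxP; rewrite expr0 scale1r map_trmx symA map_mx_id.
  by apply/mxOverP => i j; rewrite mxE complex_real.
have := hermitian_spectral_diag_real hermA.
have /hermitian_normalmx/orthomx_spectralP := hermA.
have := spectral_unitarymx (toC A).
move: (spectralmx _) (spectral_diag _) => P D uP + rD.
rewrite invmx_unitary // => eqA.
pose r i := complex.Re (D 0 i).
have rE i : (r i)%:C%C = D 0 i by rewrite RRe_real //; exact: (mxOverP rD).
have charA : char_poly A = \prod_i ('X - (r i)%:P).
  apply: (map_poly_inj (real_complex R)).
  rewrite map_char_poly /= eqA char_poly_unitary_diag // rmorph_prod /=.
  by apply: eq_bigr => i _; rewrite rmorphB /= map_polyX map_polyC /= rE.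
have := perm_eigenvalues charA; rewrite perm_sym.
have sz : size [seq r i | i <- index_enum 'I_m] = m.
  by rewrite size_map [index_enum _]unlock -enumT size_enum_ord.
move=> peig; have szE : size (eigenvalues A) = m by rewrite -(perm_size peig).
have : perm_eq (mktuple r) (eigenvalues A).
  by apply: perm_trans peig; rewrite /= enumT [index_enum _]unlock.
rewrite -[eigenvalues A]/(tval (@Tuple m _ (eigenvalues A) (introT eqP szE))).
move=> /tuple_permP[s eqs]; exists P, s; split=> //.
rewrite eqA; suff <- : D = \row_i ((eigenvalues A)`_(s i))%:C%C by [].
apply/rowP => i; rewrite mxE -rE; congr (_%:C)%C.
have /(congr1 (fun t => nth 0 t i)) := eqs.
rewrite (nth_map i) ?size_enum_ord // nth_ord_enum => ->.
by rewrite (nth_map i) ?size_enum_ord // nth_ord_enum (tnth_nth 0).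
Qed.

Local Notation eig j := (nth 0 (eigenvalues A) j).

Lemma quadratic_form_diagonalization :
  exists (P : 'M[R[i]]_m) (s : 'S_m), size (eigenvalues A) = m /\
    forall h : 'cV[R[i]]_m,
      (h^t* *m h) 0 0 = \sum_i `|(P *m h) i 0| ^+ 2 /\
      (h^t* *m toC A *m h) 0 0 =
        \sum_i (eig (s i))%:C%C * `|(P *m h) i 0| ^+ 2.
Proof.
have [P [s [uP szE eqA]]] := symmetric_diagonalization.
exists P, s; split=> // h; split.
  rewrite -{2}[h](mulKmx (unitarymx_unit uP)) invmx_unitary // !mulmxA -mulmxA.
  rewrite -[h^t* *m P^t*]map_mxM -trmx_mul mxE.
  by apply: eq_bigr => i _; rewrite !mxE normCKC.
rewrite eqA !mulmxA -[h^t* *m P^t*]map_mxM -trmx_mul -mulmxA mxE.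
apply: eq_bigr => i _; rewrite normCKC mul_mx_diag !mxE.
by rewrite mulrAC mulrC.
Qed.

Lemma toC_form (B : 'M[R]_m) (f g : 'cV[R]_m) :
  ((toC f)^t* *m toC B *m toC g) 0 0 = ((f^T *m B *m g) 0 0)%:C%C.
Proof.
have -> : (toC f)^t* = toC f^T.
  by apply/matrixP => i j; rewrite !mxE; exact: conjc_real.
by rewrite -!map_mxM mxE.
Qed.

Lemma comb_form (B : 'M[R[i]]_m) (a b : R[i]) (f g : 'cV[R[i]]_m) :
  (f^t* *m B *m g) 0 0 = 0 -> (g^t* *m B *m f) 0 0 = 0 ->
  ((a *: f + b *: g)^t* *m B *m (a *: f + b *: g)) 0 0 =
  `|a| ^+ 2 * (f^t* *m B *m f) 0 0 + `|b| ^+ 2 * (g^t* *m B *m g) 0 0.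
Proof.
move=> fg gf; have -> : (a *: f + b *: g)^t* = a^* *: f^t* + b^* *: g^t*.
  by apply/matrixP => i j; rewrite !mxE rmorphD !rmorphM.
have mx11 (M : 'M[R[i]]_1) : M 0 0 = 0 -> M = 0.
  by move=> M0; apply/matrixP => i j; rewrite !ord1 M0 mxE.
move: (f^t*) (g^t*) fg gf => u v /mx11 ug /mx11 vf.
rewrite !mulmxDl !mulmxDr -!scalemxAl -!scalemxAr ug vf.
rewrite !scaler0 addr0 add0r !scalerA !normCKC.
by move: (_ *m f) (_ *m g) => M N; rewrite !mxE.
Qed.

Lemma eigenvalues_le i j : (i <= j < size (eigenvalues A))%N -> eig i <= eig j.
Proof.
case/andP=> ij jm; apply: (sorted_leq_nth le_trans (@lexx _ _) 0) => //.
  exact: eigenvalues_sorted.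
by rewrite inE (leq_ltn_trans ij).
Qed.

Lemma rayleigh_max (g : 'cV[R]_m) :
  (g^T *m A *m g) 0 0 <= eig m.-1 * (g^T *m g) 0 0.
Proof.
have [P [s [szE]]] := quadratic_form_diagonalization.
move=> /(_ (toC g))[N Q]; rewrite -lecR rmorphM /= -toC_form Q.
rewrite -[g^T]mulmx1 -toC_form map_mx1 mulmx1 N mulr_sumr ler_sum // => i _.
rewrite ler_wpM2r ?exprn_ge0 // lecR eigenvalues_le // szE.
by have := ltn_ord (s i); move: (s i) => j /=; lia.
Qed.

(* Some nontrivial combination of [f] and [g] is orthogonal to an eigenvector of
   the least eigenvalue. *)
Lemma rayleigh_second (f g : 'cV[R]_m) :
  (1 < m)%N -> (f^T *m g) 0 0 = 0 -> (f^T *m A *m g) 0 0 = 0 ->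
  eig 1 * (f^T *m f) 0 0 <= (f^T *m A *m f) 0 0 \/
  eig 1 * (g^T *m g) 0 0 <= (g^T *m A *m g) 0 0.
Proof.
move=> m1 fg fAg.
have tr11 (M : 'M[R]_1) : M^T 0 0 = M 0 0 by rewrite mxE.
have gf : (g^T *m f) 0 0 = 0 by rewrite -tr11 trmx_mul trmxK.
have gAf : (g^T *m A *m f) 0 0 = 0.
  by rewrite -tr11 !trmx_mul trmxK symA mulmxA.
have [P [s [szE diagA]]] := quadratic_form_diagonalization.
(* Positions count from 0: [i0] is the coordinate of the least eigenvalue, and [eig 1] is the second
   least. *)
pose i0 := (s^-1)%g (Ordinal (ltnW m1)).
set c := (P *m toC f) i0 0; set d := (P *m toC g) i0 0.
(* The combination must vanish in coordinate [i0]; every other coordinate carries an eigenvalue at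
   least [eig 1]. The coefficients are complex because [P] is. *)
have [a [b [ab0 abcd]]] : exists a b : R[i],
    (a != 0) || (b != 0) /\ a * c + b * d = 0.
  have [d0|d0] := eqVneq d 0.
    by exists 0, 1; rewrite oner_eq0 orbT d0 mul0r mulr0 addr0.
  by exists d, (- c); rewrite d0 mulNr mulrC subrr.
have [N Q] := diagA (a *: toC f + b *: toC g).
have : (eig 1)%:C%C *
    ((a *: toC f + b *: toC g)^t* *m (a *: toC f + b *: toC g)) 0 0 <=
    ((a *: toC f + b *: toC g)^t* *m toC A *m (a *: toC f + b *: toC g)) 0 0.
  rewrite N Q mulr_sumr ler_sum // => i _.
  have [->|ii0] := eqVneq i i0.
    rewrite mulmxDr -!scalemxAr ![(_ + _ : matrix _ _ _) i0 0]mxE.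
    rewrite ![(_ *: _ : matrix _ _ _) i0 0]mxE abcd.
    by rewrite normr0 expr0n !mulr0.
  rewrite ler_wpM2r ?exprn_ge0 // lecR eigenvalues_le // szE ltn_ord andbT.
  rewrite lt0n; apply: contraNneq ii0 => si0; apply/eqP.
  by rewrite /i0; apply: (canRL (permK s)); apply: val_inj.
rewrite -[X in X *m (_ + _)]mulmx1 -(map_mx1 (real_complex R)).
rewrite !comb_form ?toC_form ?mulmx1 ?fg ?gf ?fAg ?gAf //.
(* If both Rayleigh quotients were below [eig 1], so would be that of the combination, as the cross
   terms are 0. *)
case: (lerP (eig 1 * (f^T *m f) 0 0)) => [|Qf]; first by left.
case: (lerP (eig 1 * (g^T *m g) 0 0)) => [|Qg]; first by right.
rewrite mulrDr !(mulrCA (eig 1)%:C%C) -!rmorphM /= => le.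
suff /(le_lt_trans le) :
  `|a| ^+ 2 * ((f^T *m A *m f) 0 0)%:C%C + `|b| ^+ 2 * ((g^T *m A *m g) 0 0)%:C%C
  < `|a| ^+ 2 * (eig 1 * (f^T *m f) 0 0)%:C%C
    + `|b| ^+ 2 * (eig 1 * (g^T *m g) 0 0)%:C%C by rewrite ltxx.
have [a0|a0] := eqVneq a 0.
  move: ab0; rewrite a0 eqxx /= normr0 expr0n !mul0r !add0r => b0.
  by rewrite ltr_pM2l ?exprn_gt0 ?normr_gt0 // ltcR.
rewrite ltr_leD //.
  by rewrite ltr_pM2l ?exprn_gt0 ?normr_gt0 // ltcR.
by rewrite ler_wpM2l ?exprn_ge0 // lecR ltW.
Qed.

End SymmetricMatrix.

(** * The Laplacian as a bilinear form on vertex functions *)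

Section Laplacian.
Variables (R : realType) (T : finType) (G : simple_graph T).

Definition vertex_vec (f : T -> R) : 'cV[R]_#|T| := \col_i f (enum_val i).

Lemma sum_enum_val (F : T -> R) : \sum_(i < #|T|) F (enum_val i) = \sum_x F x.
Proof. by rewrite [RHS](reindex _ (onW_bij _ (@enum_val_bij T))). Qed.

Lemma vertex_vec_dot (f g : T -> R) :
  ((vertex_vec f)^T *m vertex_vec g) 0 0 = \sum_x f x * g x.
Proof.
rewrite mxE -(sum_enum_val (fun x => f x * g x)).
by apply: eq_bigr => i _; rewrite !mxE.
Qed.

Lemma laplacian_sym : (laplacian R G)^T = laplacian R G.
Proof.
apply/matrixP => i j; rewrite !mxE adj_sym; congr (_ - _).
by case: eqVneq => [->|]; rewrite ?eqxx // eq_sym => /negbTE ->.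
Qed.

(** The degree is a row sum of the adjacency matrix, so each row acts as a sum of differences. In
    this one-sided form a term vanishes when [f x] is 0 or [g] is 0 at both ends, which suits
    separated supports. *)
Lemma laplacian_form (f g : T -> R) :
  ((vertex_vec f)^T *m laplacian R G *m vertex_vec g) 0 0 =
  \sum_x \sum_y (G x y)%:R * (f x * (g x - g y)).
Proof.
rewrite -mulmxA mxE.
rewrite -(sum_enum_val (fun x => \sum_y (G x y)%:R * (f x * (g x - g y)))).
apply: eq_bigr => i _; rewrite [_^T _ _]mxE [vertex_vec f _ _]mxE.
under [RHS]eq_bigr => y _ do rewrite mulrCA mulrBr.
rewrite -mulr_sumr; congr (_ * _); rewrite mulmxBl mxE [X in _ + X]mxE sumrB.
congr (_ - _).
  rewrite mul_diag_mx !mxE -mulr_suml; congr (_ * _).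
  rewrite /degree -sum1_card natr_sum big_mkcond /=.
  by apply: eq_bigr => y _; rewrite inE; case: ifP.
rewrite mxE -(sum_enum_val (fun y => (G (enum_val i) y)%:R * g y)).
by apply: eq_bigr => j _; rewrite !mxE.
Qed.

End Laplacian.

(** * Radial functions of a level function and their energies *)

Definition level_profile (R : realType) (k : nat) (z : R) (i : nat) : R :=
  if (i <= k)%N then z ^+ i else 0.

Section Levels.
Variables (R : realType) (T : finType) (G : simple_graph T).
Variables (k d : nat) (l : T -> nat).
Hypothesis hreg : regular d G.
Hypothesis l_max : forall x, (l x <= k.+1)%N.
Hypothesis l_step : forall x y, G x y -> (l y <= (l x).+1)%N.
Hypothesis l_desc : forall x, (l x <= k)%N ->
  exists2 y, G x y & l y = (l x).-1.

Definition up_edges (i : nat) : nat :=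
  \sum_x \sum_y [&& G x y, l x == i & l y == i.+1].

(** Double counting at the vertices of level [i.+1]: each has a neighbour at level [i], so it
    receives at least one edge from below and sends at most [d.-1] upwards. *)
Lemma up_edges_le i : (i < k)%N -> (up_edges i.+1 <= d.-1 * up_edges i)%N.
Proof.
move=> ik; apply: (@leq_trans (d.-1 * \sum_x (l x == i.+1))%N).
  rewrite big_distrr /=; apply: leq_sum => x _.
  case: (eqVneq (l x) i.+1) => lx /=; last first.
    by rewrite big1 // => y _; rewrite andbF.
  rewrite muln1; have [|y0 Gxy0 ly0] := l_desc (x := x); first by rewrite lx.
  have -> : d.-1 = #|[set y | G x y]%SET :\ y0|.
    rewrite -(hreg x) /degree (cardsD1 y0 [set y | G x y]%SET) inE Gxy0.
    by rewrite add1n.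
  rewrite -sum1_card [leqRHS]big_mkcond /=; apply: leq_sum => y _.
  rewrite !inE; case Gxy: (G x y) => //=; rewrite andbT.
  case: (eqVneq y y0) => [->|_] /=; last by case: eqP.
  by rewrite ly0 lx; case: eqP => //; lia.
rewrite leq_mul2l /up_edges exchange_big /=; apply/orP; right.
apply: leq_sum => y _; case: eqP => //= ly.
have [|x Gyx lx] := l_desc (x := y); first by rewrite ly.
by rewrite (bigD1 x) //= adj_sym Gyx lx ly !eqxx.
Qed.

(** Edges within a level contribute 0, and the two orientations of an edge between levels [i] and
    [i.+1] add up to [(phi i - phi i.+1) ^+ 2]. *)
Lemma level_energy (phi : nat -> R) :
  \sum_x \sum_y (G x y)%:R * (phi (l x) * (phi (l x) - phi (l y))) =
  \sum_(i < k.+1) (up_edges i)%:R * (phi i - phi i.+1) ^+ 2.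
Proof.
pose up x y : R := (G x y && (l y == (l x).+1))%:R.
transitivity (\sum_x \sum_y up x y * (phi (l x) - phi (l y)) ^+ 2).
  pose F x y := up x y * (phi (l x) * (phi (l x) - phi (l y))).
  pose H x y := up x y * (phi (l y) * (phi (l y) - phi (l x))).
  transitivity (\sum_x \sum_y (F x y + H y x)).
    apply: eq_bigr => x _; apply: eq_bigr => y _.
    rewrite /F /H /up (adj_sym G y x); case Gxy: (G x y);
      rewrite ?mul0r ?addr0 //=.
    have lyx := l_step Gxy; have lxy : (l x <= (l y).+1)%N.
      by apply: l_step; rewrite adj_sym.
    have [lE|lE] := eqVneq (l y) (l x).+1.
      by rewrite lE; case: eqP; [lia|rewrite mul0r addr0].
    have [lE'|lE'] := eqVneq (l x) (l y).+1; first by rewrite mul0r add0r.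
    have -> : l y = l x by lia.
    by rewrite subrr !mulr0 addr0.
  under eq_bigr => x _ do rewrite big_split /=.
  rewrite big_split /= [X in _ + X]exchange_big /= -big_split /=.
  apply: eq_bigr => x _; rewrite -big_split /=; apply: eq_bigr => y _.
  by rewrite /F /H; ring.
have -> : \sum_(i < k.+1) (up_edges i)%:R * (phi i - phi i.+1) ^+ 2 =
    \sum_(i < k.+1) \sum_x \sum_y
      [&& G x y, l x == i & l y == i.+1]%:R * (phi i - phi i.+1) ^+ 2.
  apply: eq_bigr => i _; rewrite /up_edges natr_sum mulr_suml.
  by apply: eq_bigr => x _; rewrite natr_sum mulr_suml.
rewrite [RHS]exchange_big /=; apply: eq_bigr => x _.
rewrite [RHS]exchange_big /=; apply: eq_bigr => y _.
case: (leqP (l x) k) => lx.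
  rewrite (bigD1 (Ordinal (lx : l x < k.+1)%N)) //= big1 ?addr0 => [|i].
    rewrite eqxx /= /up; case Gxy: (G x y) => /=; last by rewrite !mul0r.
    by case: eqP => [->|_] //; rewrite !mul0r.
  by rewrite -val_eqE /= eq_sym => /negbTE ->; rewrite andbF mul0r.
(* At level [k.+1] no edge goes up, since levels stop there. *)
rewrite big1 => [|i _].
  rewrite /up; case: eqP => [ly|_]; last by rewrite andbF mul0r.
  by have := l_max y; lia.
by case: eqP => [E|_]; [have := ltn_ord i; lia|rewrite andbF mul0r].
Qed.

(** The profile drops to 0 at level [k.+1], so the last term lacks the factor [(1 - z) ^+ 2]. *)
Lemma level_profile_energy (z : R) :
  \sum_(i < k.+1) (up_edges i)%:R *
    (level_profile k z i - level_profile k z i.+1) ^+ 2 =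
  (1 - z) ^+ 2 * (\sum_(i < k) (up_edges i)%:R * (z ^+ 2) ^+ i)
  + (up_edges k)%:R * (z ^+ 2) ^+ k.
Proof.
rewrite big_ord_recr /= /level_profile leqnn ltnn subr0 -exprM mulnC exprM.
congr (_ + _); rewrite mulr_sumr; apply: eq_bigr => i _.
by rewrite ltnW // ltn_ord -exprM mulnC exprM (exprS z); ring.
Qed.

(** At [z = q^-1] this is the test function [f], at [z = - q^-1] its alternating version [g]. *)
Definition level_vec (z : R) : 'cV[R]_#|T| :=
  vertex_vec (fun x => level_profile k z (l x)).

Local Notation energy z :=
  (((level_vec z)^T *m laplacian R G *m level_vec z) 0 0).

Lemma level_vec_energy (z : R) :
  energy z =
  (1 - z) ^+ 2 * (\sum_(i < k) (up_edges i)%:R * (z ^+ 2) ^+ i)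
  + (up_edges k)%:R * (z ^+ 2) ^+ k.
Proof. by rewrite laplacian_form level_energy level_profile_energy. Qed.

Lemma level_vec_normN (z : R) :
  ((level_vec (- z))^T *m level_vec (- z)) 0 0 =
  ((level_vec z)^T *m level_vec z) 0 0.
Proof.
rewrite !vertex_vec_dot; apply: eq_bigr => x _; rewrite /level_profile.
by case: ifP => // _; rewrite -!expr2 -!exprM mulnC !exprM sqrrN.
Qed.

Lemma level_vec_norm_gt0 (z : R) x :
  l x = 0%N -> 0 < ((level_vec z)^T *m level_vec z) 0 0.
Proof.
move=> lx; rewrite vertex_vec_dot (bigD1 x) //= {1 2}/level_profile lx /=.
rewrite expr0 mulr1 ltr_pwDl // sumr_ge0 // => y _.
by rewrite -expr2 sqr_ge0.
Qed.

(* Each level contributes to the two energies in the ratio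
   (q - 1)^2 : (q + 1)^2, except for the edges leaving the last level, which
   contribute the same amount [W] to both; regularity makes [W] at most the
   average of the other weighted counts, whence the error term. *)
Lemma level_vec_energy_ratio (q : R) :
  (0 < k)%N -> 0 < q -> q ^+ 2 = d.-1%:R -> (0 < up_edges 0)%N ->
  0 < energy (- q^-1) /\
  energy q^-1 < ((q - 1) ^+ 2 / (q + 1) ^+ 2 + 4 / ((k%:R + 1) * q))
                * energy (- q^-1).
Proof.
move=> k0 q0 q2 e0; rewrite !level_vec_energy sqrrN opprK.
have t0 : 0 < q^-1 ^+ 2 by rewrite exprn_gt0 ?invr_gt0.
have q2t : q ^+ 2 * q^-1 ^+ 2 = 1 by rewrite -exprMn divff ?expr1n // gt_eqF.
move: (q^-1 ^+ 2) t0 q2t => t t0 q2t; have t_ge0 := ltW t0.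
set S := \sum_(i < k) _; set W := _ * t ^+ k.
(* Since [t] is the inverse of [d.-1], [up_edges_le] makes the weighted counts nonincreasing up to
   level [k], where the value is [W]. The induction runs downwards from [k]. *)
have w_decr i : (i <= k)%N -> W <= (up_edges i)%:R * t ^+ i.
  move=> ik; rewrite -(subKn ik); elim: (k - i)%N => [|j IHj].
    by rewrite subn0.
  have [jk|jk] := leqP k j.
    by have -> : (k - j.+1 = k - j)%N by lia.
  apply: le_trans IHj _.
  have -> : (k - j = (k - j.+1).+1)%N by lia.
  rewrite exprSr mulrA mulrAC ler_wpM2r ?exprn_ge0 //.
  have : (up_edges (k - j.+1).+1)%:R <= (q ^+ 2 * (up_edges (k - j.+1))%:R : R).
    by rewrite q2 -natrM ler_nat up_edges_le //; lia.
  move=> /(ler_wpM2r t_ge0) le; apply: le_trans le _.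
  by rewrite mulrAC q2t mul1r.
have W0 : 0 <= W by rewrite mulr_ge0 ?exprn_ge0.
have kWS : k%:R * W <= S.
  rewrite mulr_natl -[k in W *+ k]card_ord -sumr_const ler_sum // => i _.
  by rewrite w_decr // ltnW.
have S0 : 0 < S.
  rewrite /S; case: (k) k0 => // k' _; rewrite big_ord_recl ltr_pwDl //.
    by rewrite expr0 mulr1 ltr0n.
  by rewrite sumr_ge0 // => i _; rewrite mulr_ge0 ?exprn_ge0.
have q10 : 0 < q^-1 by rewrite invr_gt0.
set Q := (1 + q^-1) ^+ 2 * S + W.
have SQ : S + W < Q by rewrite ltrD2r; nra.
have K0 : 0 < k%:R + 1 :> R by rewrite ltr_wpDl.
split; first by apply: lt_trans SQ; rewrite ltr_pwDl.
(* This is the claim with denominators cleared: the main terms in [S] cancel, and those in [W] leave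
   [- 4 q W / (q + 1)^2], which the error term must absorb. *)
have lt : q ^+ 2 * ((k%:R + 1) * W) < (q + 1) ^+ 2 * Q.
  apply: (@le_lt_trans _ _ (q ^+ 2 * (S + W))).
    by rewrite ler_pM2l ?exprn_gt0 // mulrDl mul1r lerD2r.
  apply: ltr_pM => //; rewrite ?sqr_ge0 ?addr_ge0 ?(ltW S0) //.
  by nra.
rewrite -subr_gt0.
have -> : ((q - 1) ^+ 2 / (q + 1) ^+ 2 + 4 / ((k%:R + 1) * q)) * Q
    - ((1 - q^-1) ^+ 2 * S + W)
    = 4 / ((k%:R + 1) * q * (q + 1) ^+ 2)
      * ((q + 1) ^+ 2 * Q - q ^+ 2 * ((k%:R + 1) * W)).
  by rewrite /Q; field; rewrite !gt_eqF //; lra.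
by rewrite mulr_gt0 ?subr_gt0 // divr_gt0 // !mulr_gt0 ?exprn_gt0 //; lra.
Qed.

End Levels.

(** * Balls around a vertex set, distance levels and walks *)

Section Balls.
Variables (T : finType) (G : simple_graph T) (A : {set T}).

(** The ball of radius [i] about [A], grown step by step so that membership is decidable; its link
    with the infimum [dist] goes through walks. *)
Definition nbhd (i : nat) : {set T} :=
  iter i (fun B : {set T} => B :|: [set w | [exists z in B, G z w]]) A.

Lemma nbhdS i w :
  (w \in nbhd i.+1) = (w \in nbhd i) || [exists z in nbhd i, G z w].
Proof. by rewrite /= !inE. Qed.

Lemma nbhd_mono i j : (i <= j)%N -> nbhd i \subset nbhd j.
Proof.
elim: j => [|j IHj]; first by rewrite leqn0 => /eqP ->.
rewrite leq_eqVlt => /predU1P[-> //|]; rewrite ltnS => /IHj/subset_trans; apply.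
exact: subsetUl.
Qed.

(* The distance to [A], truncated at [k.+1]. *)
Definition level (k : nat) (w : T) : nat :=
  find (fun i => w \in nbhd i) (iota 0 k.+1).

Lemma level_max k w : (level k w <= k.+1)%N.
Proof. by rewrite -[X in (_ <= X)%N](size_iota 0) find_size. Qed.

Lemma level_le k i w : (i <= k)%N -> (level k w <= i)%N = (w \in nbhd i).
Proof.
move=> ik; apply/idP/idP => [lwi|wi].
  have : has (fun j => w \in nbhd j) (iota 0 k.+1).
    by rewrite has_find size_iota ltnS (leq_trans lwi).
  move=> /(nth_find 0%N); rewrite -/(level k w) nth_iota
    ?ltnS ?(leq_trans lwi) //.
  exact/subsetP/nbhd_mono.
rewrite leqNgt; apply/negP => /(before_find 0%N).
by rewrite nth_iota ?ltnS // add0n wi.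
Qed.

Lemma level_eq0 k w : (level k w == 0%N) = (w \in A).
Proof. by rewrite -leqn0 level_le. Qed.

Lemma level_step k z w : G z w -> (level k w <= (level k z).+1)%N.
Proof.
move=> Gzw; have [kz|zk] := leqP k (level k z).
  by apply: leq_trans (level_max k w) _.
rewrite level_le // nbhdS; apply/orP; right; apply/existsP; exists z.
by rewrite Gzw andbT -(@level_le k) // ltnW.
Qed.

(** A vertex new in a ball has a neighbour in the previous ball, and one step lowers the level by at
    most one. *)
Lemma level_desc k w : (0 < level k w <= k)%N ->
  exists2 z, G w z & level k z = (level k w).-1.
Proof.
case lw: (level k w) => [//|i] /andP[_ ik].
have : w \in nbhd i.+1 by rewrite -(@level_le k) // lw.
rewrite nbhdS -(@level_le k) ?(ltnW ik) // lw ltnn /=.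
case/existsP => z /andP[]; rewrite -(@level_le k) ?(ltnW ik) // => lz Gzw.
exists z; first by rewrite adj_sym.
by have := level_step k Gzw; rewrite lw; lia.
Qed.

End Balls.

(** The walk [p] is an accumulator, prolonged through smaller and smaller balls until it reaches
    [A]. *)
Lemma nbhd_walk (T : finType) (G : simple_graph T) (A : {set T}) i a z p :
  path G a p -> last a p = z -> z \in nbhd G A i ->
  exists b q, [/\ b \in A, path G a q, last a q = b & (size q <= size p + i)%N].
Proof.
elim: i z p => [|i IHi] z p pathp lastp.
  by move=> zA; exists z, p; split => //; rewrite addn0.
rewrite nbhdS => /orP[/(IHi _ _ pathp lastp)|/existsP[w /andP[wi Gwz]]].
  by case=> b [q [bA pathq lastq sz]]; exists b, q; split=> //; lia.
have pathpw : path G a (rcons p w) by rewrite rcons_path pathp lastp adj_sym.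
have [b [q [bA pathq lastq sz]]] := IHi w _ pathpw (last_rcons _ _ _) wi.
by exists b, q; split => //; rewrite -addSnnS -(size_rcons p w).
Qed.

(** A walk from [z] to [A] is reversed, then prolonged from [z] to [B]. *)
Lemma nbhd_meet (T : finType) (G : simple_graph T) (A B : {set T}) i j z :
  z \in nbhd G A i -> z \in nbhd G B j ->
  exists a b q, [/\ a \in A, b \in B, path G a q, last a q = b &
    (size q <= i + j)%N].
Proof.
move=> zA zB.
have [a [q [aA pathq lastq sz]]] :=
  @nbhd_walk _ G A i z z [::] isT erefl zA.
have pathr : path G a (rev (belast z q)).
  rewrite -lastq rev_path; apply: sub_path pathq => x y.
  by rewrite adj_sym.
have lastr : last a (rev (belast z q)) = z.
  by case: (q) lastq => //= b r _; rewrite rev_cons last_rcons.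
have [b [r [bB pathb lastb szr]]] := nbhd_walk pathr lastr zB.
exists a, b, r; split=> //; apply: leq_trans szr _.
by rewrite size_rev size_belast leq_add2r.
Qed.

(** The infimum ranges over simple paths, so the walk is first shortened to one. *)
Lemma dist_le_walk (R : realType) (T : finType) (G : simple_graph T) a p :
  path G a p -> (dist R G a (last a p) <= (size p)%:R%:E)%E.
Proof.
move=> pathp; have [q pathq uq sub] := shortenP pathp.
apply: (@le_trans _ _ (size q)%:R%:E).
  by apply: ereal_inf_lbound; exists q.
by rewrite lee_fin ler_nat; case/andP: uq => _ /uniq_leq_size; apply.
Qed.

(** * Levels around an edge and separation of two distant edges *)

Section EdgeLevels.
Variables (T : finType) (G : simple_graph T) (x y : T) (k : nat).
Hypothesis Gxy : G x y.
Local Notation l := (level G [set x; y] k).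

(** At level 0 the truncated predecessor is again 0, and the other end of the edge is the neighbour
    sought. *)
Lemma edge_level_desc w : (l w <= k)%N -> exists2 z, G w z & l z = (l w).-1.
Proof.
move=> lk; have [lw0|] := posnP (l w); last first.
  by move=> lw; apply: level_desc; rewrite lw.
have /eqP := lw0; rewrite level_eq0 !inE lw0 => /pred2P[->|->].
  by exists y => //; apply/eqP; rewrite level_eq0 !inE eqxx orbT.
by exists x; [rewrite adj_sym|apply/eqP; rewrite level_eq0 !inE eqxx].
Qed.

Lemma edge_up_edges0 d : regular d G -> (2 <= d)%N -> (0 < up_edges G l 0)%N.
Proof.
move=> reg d2.
have [w] : exists w, w \in [set z | G x z] :\ y.
  apply/card_gt0P; move: d2; rewrite -(reg x) /degree.
  by rewrite (cardsD1 y [set z | G x z]) inE Gxy.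
rewrite !inE => /andP[wy Gxw].
have lx : l x = 0%N by apply/eqP; rewrite level_eq0 !inE eqxx.
have lw : l w = 1%N.
  apply/eqP; rewrite eqn_leq -[X in (_ <= X)%N]/(0.+1) -lx level_step //= lx.
  rewrite lt0n level_eq0 !inE (negbTE wy) orbF.
  by apply: contraTneq Gxw => ->; rewrite adj_irrefl.
by rewrite /up_edges (bigD1 x) //= (bigD1 w) //= Gxw lx lw.
Qed.

End EdgeLevels.

(** If [z] and [w] were equal or adjacent, [z] would lie within [k] of one edge and [k.+1] of the
    other, giving a walk of length at most [2 * k + 1] between their ends. *)
Lemma levels_separated (R : realType) (T : finType) (G : simple_graph T)
    (x y u v : T) (k : nat) :
  ((2 * k + 2)%:R%:E <= edge_dist R G x y u v)%E ->
  forall z w, (level G [set x; y] k z <= k)%N ->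
    (level G [set u; v] k w <= k)%N -> (z == w) || G z w = false.
Proof.
rewrite /edge_dist !le_min => /andP[/andP[xu xv] /andP[yu yv]] z w.
rewrite !level_le // => zx wu; apply/negbTE/negP => zw.
have zu : z \in nbhd G [set u; v] k.+1.
  rewrite nbhdS; case/orP: zw => [/eqP ->|Gzw]; first by rewrite wu.
  by apply/orP; right; apply/existsP; exists w; rewrite wu adj_sym.
have [a [b [q [aA bB pathq lastq sz]]]] := nbhd_meet zx zu.
have : ((2 * k + 2)%:R%:E <= dist R G a b)%E.
  by move: aA bB; rewrite !inE => /pred2P[] -> /pred2P[] ->.
move=> /le_trans/(_ (_ : _ <= (size q)%:R%:E)%E).
rewrite -lastq dist_le_walk // lee_fin ler_nat => /(_ isT); lia.
Qed.

(** * Comparison of the second and the last Laplacian eigenvalue *)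

Theorem theorem1p4 (R : realType) (d k n : nat) (hd : (2 <= d)%N)
    (hk : (1 <= k)%N) (T : finType) (hn : #|T| = n) (G : simple_graph T)
    (hreg : regular d G)
    (hedges : exists x y u v : T,
      [/\ G x y, G u v & ((2 * k + 2)%:R%:E <= edge_dist R G x y u v)%E]) :
  lambda R G 2 / lambda R G n <
    (d%:R - 2 * Num.sqrt (d%:R - 1)) / (d%:R + 2 * Num.sqrt (d%:R - 1))
    + 4 / ((k%:R + 1) * Num.sqrt (d%:R - 1)).
Proof.
case: n / hn; case: hedges => x [y [u [v [Gxy Guv far]]]].
have dE : d%:R - 1 = d.-1%:R :> R.
  by rewrite -[in LHS](ltn_predK hd) -natr1 addrK.
set q := Num.sqrt _.
have q2 : q ^+ 2 = d.-1%:R by rewrite /q dE sqr_sqrtr // ler0n.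
have q0 : 0 < q by rewrite sqrtr_gt0 dE ltr0n; lia.
have dq : d%:R = q ^+ 2 + 1 by rewrite q2 -dE subrK.
(* As [d = q ^+ 2 + 1], the main term of the bound is the ratio of squares in
   [level_vec_energy_ratio]. *)
have -> : d%:R - 2 * q = (q - 1) ^+ 2 by rewrite dq; ring.
have -> : d%:R + 2 * q = (q + 1) ^+ 2 by rewrite dq; ring.
set rho := _ + _.
have rho0 : 0 < rho.
  rewrite ltr_wpDl ?divr_ge0 ?sqr_ge0 //.
  by rewrite divr_gt0 // mulr_gt0 // ltr_wpDl.
have card_T : (1 < #|T|)%N.
  rewrite (cardD1 x) (cardD1 y) !inE /= (_ : y != x) //.
  by apply: contraTneq Gxy => ->; rewrite adj_irrefl.
(* Stated for any edge, since [rayleigh_second] does not tell which of the two satisfies the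
   hypothesis. *)
have ratio a b : G a b ->
    let f := level_vec k (level G [set a; b] k) q^-1 in
    lambda R G 2 * (f^T *m f) 0 0 <= (f^T *m laplacian R G *m f) 0 0 ->
    lambda R G 2 / lambda R G #|T| < rho.
  move=> Gab; set l := level _ _ _ => f lef.
  have la : l a = 0%N by apply/eqP; rewrite level_eq0 !inE eqxx.
  have f0 : 0 < (f^T *m f) 0 0 by exact: (level_vec_norm_gt0 _ _ la).
  have [g0 fg] := level_vec_energy_ratio hreg (level_max G _ k)
    (@level_step _ G _ k) (edge_level_desc Gab) hk q0 q2
    (edge_up_edges0 k Gab hreg hd).
  set g := level_vec _ _ (- q^-1) in g0 fg.
  have := rayleigh_max (laplacian_sym R G) g.
  rewrite level_vec_normN -/f -/(lambda R G #|T|) => gle.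
  (* Dividing by the last eigenvalue is safe: the alternating function has positive energy. *)
  have ln0 : 0 < lambda R G #|T|.
    by rewrite -(pmulr_lgt0 _ f0); apply: lt_le_trans gle.
  rewrite ltr_pdivrMr // -(ltr_pM2r f0) -mulrA.
  apply: (le_lt_trans lef); apply: (lt_le_trans fg).
  by rewrite ler_pM2l.
have sep := levels_separated far.
have [||lef|lef] := rayleigh_second (laplacian_sym R G)
    (f := level_vec k (level G [set x; y] k) q^-1)
    (g := level_vec k (level G [set u; v] k) q^-1) card_T.
- rewrite vertex_vec_dot big1 // => z _; rewrite /level_profile.
  case: ifP => lz; last by rewrite mul0r.
  case: ifP => lz'; last by rewrite mulr0.
  by have := sep _ _ lz lz'; rewrite eqxx.
(* A nonzero term would need a vertex near the first edge that equals or is adjacent to one near the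
   second. *)
- rewrite laplacian_form big1 // => z _; rewrite big1 // => w _.
  case Gzw: (G z w); last by rewrite mul0r.
  rewrite /level_profile; case: ifP => lz; last by rewrite mul0r mulr0.
  case: ifP => lz'; first by have := sep _ _ lz lz'; rewrite eqxx.
  case: ifP => lw; first by have := sep _ _ lz lw; rewrite Gzw orbT.
  by rewrite subrr !mulr0.
- exact: ratio Gxy lef.
- exact: ratio Guv lef.
Qed.
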